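(* The VCG mechanism for the crowdsourced delivery system (for a driver group $\mathcal{A}_{od}$ with task allocation $\mathbf{f}_{od}$) achieves truth-telling and efficient matching, that is: (i) (Truth-telling) no driver has an incentive to make a false bid: for every driver $a\in\mathcal{A}_{od}$ with true cost vector $\mathbf{c}_a$, every bid vector $\mathbf{b}_a\in\mathbb{R}^{\mathcal{T}}$ and every profile $\mathbf{b}_{-a}$ of bids of the other drivers, $$\pi_a(\mathbf{c}_a,\mathbf{b}_{-a})\ \ge\ \pi_a(\mathbf{b}_a,\mathbf{b}_{-a}).$$ (ii) (Efficiency) the matching pattern realized by the mechanism when all drivers bid truthfully, $\mathbf{y}(\mathbf{c})$ with $\mathbf{c}=(\mathbf{c}_a)_{a\in\mathcal{A}_{od}}$, is an optimal solution of the matching problem of maximizing $\sum_{a\in\mathcal{A}_{od}}\sum_{rs\in\mathcal{T}}(\overline{c}_{rs}-c^{rs}_a)y^{rs}_a$ over $\mathbf{y}$ subject to $\sum_{rs\in\mathcal{T}}y^{rs}_a=1$ for all $a\in\mathcal{A}_{od}$, $\sum_{a\in\mathcal{A}_{od}}y^{rs}_a=f^{rs}_{od}$ for all $rs\in\mathcal{T}$, and $y^{rs}_a\in\{0,1\}$.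
   Context: $\mathcal{A}_{od}$ is a finite set of drivers (those with origin-destination pair $(o,d)$), $\mathcal{T}$ a finite set of pickup-delivery pairs $rs$; $\overline{c}_{rs}\in\mathbb{R}$ is the cost for a dedicated vehicle to perform a task for $rs$. Driver $a$ has true (private) cost vector $\mathbf{c}_a=(c^{rs}_a)_{rs\in\mathcal{T}}\in\mathbb{R}^{\mathcal{T}}$. The nonnegative integers $\mathbf{f}_{od}=(f^{rs}_{od})_{rs\in\mathcal{T}}$ are the numbers of tasks allocated to the group, with $\sum_{rs\in\mathcal{T}}f^{rs}_{od}=|\mathcal{A}_{od}|$. The VCG mechanism for the system is as follows. Step 1: each driver $a\in\mathcal{A}_{od}$ submits a bid vector $\mathbf{b}_a=(b^{rs}_a)_{rs\in\mathcal{T}}\in\mathbb{R}^{\mathcal{T}}$ (declared costs). Write $\mathbf{b}=(\mathbf{b}_a,\mathbf{b}_{-a})$, where $\mathbf{b}_{-a}$ are the bids of $\mathcal{A}_{od}\setminus\{a\}$. Step 2: the manager chooses a matching $\mathbf{y}(\mathbf{b})=[y^{rs}_a(\mathbf{b})]$ that maximizes $Z(\mathbf{y}|\mathbf{b})=\sum_{a\in\mathcal{A}_{od}}\sum_{rs\in\mathcal{T}}(\overline{c}_{rs}-b^{rs}_a)y^{rs}_a$ over all $\mathbf{y}$ with $y^{rs}_a\in\{0,1\}$, $\sum_{rs}y^{rs}_a=1$ for all $a\in\mathcal{A}_{od}$, and $\sum_{a\in\mathcal{A}_{od}}y^{rs}_a=f^{rs}_{od}$ for all $rs\in\mathcal{T}$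 (a fixed selection of a maximizer for each $\mathbf{b}$). Step 3: driver $a$ receives the reward $$w_a(\mathbf{b}_a,\mathbf{b}_{-a})=\Big(Z^\star_{-a}(\mathbf{b}_a,\mathbf{b}_{-a})+\sum_{rs\in\mathcal{T}}\overline{c}_{rs}\,y^{rs}_a(\mathbf{b})\Big)-\max_{\mathbf{y}_{-a}}Z_{-a}(\mathbf{y}_{-a}|\mathbf{b}_{-a}),$$ where $Z^\star_{-a}(\mathbf{b})=\sum_{a'\in\mathcal{A}_{od}\setminus\{a\}}\sum_{rs}(\overline{c}_{rs}-b^{rs}_{a'})y^{rs}_{a'}(\mathbf{b})$ is the maximal objective value minus the contribution of $a$, and $\max_{\mathbf{y}_{-a}}Z_{-a}(\mathbf{y}_{-a}|\mathbf{b}_{-a})$ is the optimal objective value achievable without participation of $a$: the maximum of $\sum_{a'\in\mathcal{A}_{od}\setminus\{a\}}\sum_{rs}(\overline{c}_{rs}-b^{rs}_{a'})y^{rs}_{a'}$ over $y^{rs}_{a'}\in\{0,1\}$ with $\sum_{rs}y^{rs}_{a'}=1$ for all $a'\ne a$ and $\sum_{a'\neq a}y^{rs}_{a'}\le f^{rs}_{od}$ for all $rs$. The payoff of driver $a$ is $\pi_a(\mathbf{b}_a,\mathbf{b}_{-a})=w_a(\mathbf{b}_a,\mathbf{b}_{-a})-\sum_{rs\in\mathcal{T}}c^{rs}_a\,y^{rs}_a(\mathbf{b}_a,\mathbf{b}_{-a})$. *)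

(* Defs.v *)
From mathcomp Require Import all_boot all_order all_algebra.
From mathcomp Require Import boolp classical_sets reals.

Set Implicit Arguments.
Unset Strict Implicit.
Unset Printing Implicit Defensive.

Import Order.TTheory GRing.Theory Num.Theory.
Local Open Scope ring_scope.

(** Throughout, [D] is a type of drivers (the whole group, or the group with one
    driver removed) and [T] is the type of pickup-delivery pairs. *)

Definition cost_vector (R : realType) (T : finType) := {ffun T -> R}.

Definition bid_profile (R : realType) (D T : finType) :=
  {ffun D -> cost_vector R T}.

(** A 0/1 array; its entries are used as integers and reals through the
    coercion from [bool] to [nat]. *)
Definition matching (D T : finType) := {ffun D -> {ffun T -> bool}}.

Definition objective (R : realType) (D T : finType) (cbar : cost_vector R T)
    (b : bid_profile R D T) (y : matching D T) : R :=
  \sum_(a : D) \sum_(rs : T) (cbar rs - b a rs) * (y a rs)%:R.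

Definition one_task_each (D T : finType) (y : matching D T) : Prop :=
  forall a : D, (\sum_(rs : T) y a rs = 1)%N.

Definition feasible (D T : finType) (f : T -> nat) (y : matching D T) : Prop :=
  one_task_each y /\ forall rs : T, (\sum_(a : D) y a rs = f rs)%N.

Definition subfeasible (D T : finType) (f : T -> nat) (y : matching D T) : Prop :=
  one_task_each y /\ forall rs : T, (\sum_(a : D) y a rs <= f rs)%N.

Definition optimal_matching (R : realType) (D T : finType)
    (cbar : cost_vector R T) (f : T -> nat) (b : bid_profile R D T)
    (y : matching D T) : Prop :=
  feasible f y /\
  forall y' : matching D T,
    feasible f y' -> objective cbar b y' <= objective cbar b y.

(** [y] is the manager's selection of one maximizer for each bid profile. *)
Definition matching_rule (R : realType) (A T : finType)
    (cbar : cost_vector R T) (f : T -> nat)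
    (y : bid_profile R A T -> matching A T) : Prop :=
  forall b : bid_profile R A T, optimal_matching cbar f b (y b).

Definition others (A : finType) (a : A) : finType := {a' : A | a' != a}.

(** The profile [(b_a, b_{-a})]: [insub a'] is [None] exactly when [a' = a]. *)
Definition join_bids (R : realType) (A T : finType) (a : A)
    (ba : cost_vector R T) (bma : bid_profile R (others a) T) :
    bid_profile R A T :=
  [ffun a' => if insub a' is Some a'' then bma a'' else ba].

(** The feasible set is finite, so the supremum is a maximum as soon as that set
    is nonempty; see [best_value_withoutP]. *)
Definition best_value_without (R : realType) (A T : finType)
    (cbar : cost_vector R T) (f : T -> nat) (a : A)
    (bma : bid_profile R (others a) T) : R :=
  sup [set objective cbar bma y | y in
        [set y : matching (others a) T | subfeasible f y]]%classic.

Definition others_value (R : realType) (A T : finType) (cbar : cost_vector R T)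
    (a : A) (b : bid_profile R A T) (y : matching A T) : R :=
  \sum_(a' : A | a' != a) \sum_(rs : T) (cbar rs - b a' rs) * (y a' rs)%:R.

Definition reward (R : realType) (A T : finType) (cbar : cost_vector R T)
    (f : T -> nat) (y : bid_profile R A T -> matching A T) (a : A)
    (ba : cost_vector R T) (bma : bid_profile R (others a) T) : R :=
  let b := join_bids ba bma in
  (others_value cbar a b (y b) + \sum_(rs : T) cbar rs * (y b a rs)%:R)
  - best_value_without cbar f bma.

(** [ca] is the true cost vector of driver [a]. *)
Definition payoff (R : realType) (A T : finType) (cbar : cost_vector R T)
    (f : T -> nat) (y : bid_profile R A T -> matching A T) (a : A)
    (ca ba : cost_vector R T) (bma : bid_profile R (others a) T) : R :=
  reward cbar f y ba bma
  - \sum_(rs : T) ca rs * (y (join_bids ba bma) a rs)%:R.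

(** Well-posedness: when the numbers of tasks add up to the number of drivers,
    a matching rule exists and the value without a driver is a maximum. *)

Lemma feasible_exists (A T : finType) (f : T -> nat) :
  (\sum_(rs : T) f rs = #|A|)%N -> exists y : matching A T, feasible f y.
Proof.
move=> hf.
pose s := flatten [seq nseq (f rs) rs | rs <- enum T].
have sz : size s = #|A|.
  rewrite size_flatten /shape -map_comp sumnE big_map -hf big_enum /=.
  by apply: eq_bigr => rs _; rewrite size_nseq.
pose g (a : A) := tnth (in_tuple s) (cast_ord (esym sz) (enum_rank a)).
exists [ffun a => [ffun rs => g a == rs]]; split => [a|rs].
  rewrite (bigD1 (g a)) //= !ffunE eqxx big1 ?addn0 // => rs ne.
  by rewrite !ffunE eq_sym (negbTE ne).
transitivity (count_mem rs s).
  transitivity (\sum_(i < size s) (tnth (in_tuple s) i == rs))%N.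
    rewrite (reindex (fun a : A => cast_ord (esym sz) (enum_rank a))) /=.
      by apply: eq_bigr => a _; rewrite !ffunE.
    exists (fun i => enum_val (cast_ord sz i)) => i _.
      by rewrite cast_ordKV enum_rankK.
    by rewrite enum_valK cast_ordK.
  rewrite -sum1_count (big_tnth _ _ s) [RHS]big_mkcond /=.
  by apply: eq_bigr => i _; case: eqP.
rewrite count_flatten -map_comp sumnE big_map big_enum /=.
rewrite (bigD1 rs) //= count_nseq /= eqxx mul1n big1 ?addn0 // => t ne.
by rewrite count_nseq /= (negbTE ne).
Qed.

Lemma objective_max (R : realType) (D T : finType) (cbar : cost_vector R T)
    (b : bid_profile R D T) (P : matching D T -> Prop) :
  (exists y, P y) ->
  exists2 y, P y & forall y', P y' -> objective cbar b y' <= objective cbar b y.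
Proof.
case=> y0 Py0.
have P0 : `[< P y0 >] by apply/asboolP.
case: (@arg_maxP _ _ _ y0 (fun y => `[< P y >]) (objective cbar b) P0).
move=> y /asboolP Py ymax; exists y => // y' Py'.
by apply: ymax; apply/asboolP.
Qed.

Lemma matching_rule_exists (R : realType) (A T : finType)
    (cbar : cost_vector R T) (f : T -> nat) :
  (\sum_(rs : T) f rs = #|A|)%N ->
  exists y : bid_profile R A T -> matching A T, matching_rule cbar f y.
Proof.
move=> hf.
suff /boolp.choice[y yP] : forall b : bid_profile R A T,
    exists y, optimal_matching cbar f b y by exists y.
move=> b.
have [y fy ymax] := objective_max cbar b (feasible_exists hf).
by exists y.
Qed.

Lemma best_value_withoutP (R : realType) (A T : finType)
    (cbar : cost_vector R T) (f : T -> nat) (a : A)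
    (bma : bid_profile R (others a) T) :
  (\sum_(rs : T) f rs = #|A|)%N ->
  exists2 y : matching (others a) T,
    subfeasible f y /\ best_value_without cbar f bma = objective cbar bma y
    & forall y', subfeasible f y' -> objective cbar bma y' <= objective cbar bma y.
Proof.
move=> hf.
have sub_ex : exists y : matching (others a) T, subfeasible f y.
  have [y [y1 yf]] := feasible_exists hf.
  exists [ffun a' => y (val a')]; split => [a'|rs].
    by rewrite -[RHS](y1 (val a')); apply: eq_bigr => rs _; rewrite ffunE.
  rewrite -yf (bigID (fun a' => a' != a)) /=.
  rewrite (eq_bigr (fun a' : others a => y (val a') rs : nat)); last first.
    by move=> a' _; rewrite ffunE.
  by rewrite -(big_sub (fun a' => a' != a) (fun a' => y a' rs : nat)) leq_addr.
have [y fy ymax] := objective_max cbar bma sub_ex.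
exists y => //; split => //.
apply/eqP; rewrite eq_le; apply/andP; split.
  apply: ge_sup; first by exists (objective cbar bma y), y.
  by move=> _ [y' fy' <-]; apply: ymax.
apply: ub_le_sup; last by exists y.
by exists (objective cbar bma y) => _ [y' fy' <-]; apply: ymax.
Qed.

(* Main.v *)
Require Import Defs.
From mathcomp Require Import all_boot all_order all_algebra.
From mathcomp Require Import reals ring.
Import Order.TTheory GRing.Theory Num.Theory.
Local Open Scope ring_scope.

(** The reward pays driver [a] the declared surplus of the other drivers plus
    the dedicated-vehicle cost of the task that [a] performs.  After subtracting
    the true cost of [a], what is left is the objective of the whole group,
    evaluated with the true costs of [a], at the matching that the mechanism
    selects, minus a term that does not depend on the bid of [a]
    ([payoff_objective]).  A bid thus affects the payoff only through the
    selected matching, and it is the truthful bid that makes the manager maximize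
    this very objective; every other bid selects some feasible matching, which
    cannot do better.  Efficiency is the optimality of the matching rule at the
    profile of true costs. *)

Lemma join_bids_self (R : realType) (A T : finType) (a : A)
    (ba : cost_vector R T) (bma : bid_profile R (others a) T) :
  join_bids ba bma a = ba.
Proof. by rewrite ffunE insubF // eqxx. Qed.

Lemma join_bids_other (R : realType) (A T : finType) (a a' : A)
    (ba ba' : cost_vector R T) (bma : bid_profile R (others a) T) :
  a' != a -> join_bids ba bma a' = join_bids ba' bma a'.
Proof. by move=> ne; rewrite !ffunE insubT. Qed.

Lemma others_value_join_bids (R : realType) (A T : finType)
    (cbar : cost_vector R T) (a : A) (ba ba' : cost_vector R T)
    (bma : bid_profile R (others a) T) (z : matching A T) :
  others_value cbar a (join_bids ba bma) z =
  others_value cbar a (join_bids ba' bma) z.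
Proof. by apply: eq_bigr => a' ne; rewrite (join_bids_other _ _ _ _ _ _ ba'). Qed.

Lemma objective_split (R : realType) (A T : finType) (cbar : cost_vector R T)
    (a : A) (b : bid_profile R A T) (z : matching A T) :
  objective cbar b z =
  \sum_(rs : T) (cbar rs - b a rs) * (z a rs)%:R + others_value cbar a b z.
Proof. by rewrite /objective (bigD1 a). Qed.

(** The bid [ba] occurs on the right only inside the selected matching: the
    objective there is taken at the true costs [ca], which is what aligns the
    interest of the driver with that of the manager. *)
Lemma payoff_objective (R : realType) (A T : finType) (cbar : cost_vector R T)
    (f : T -> nat) (y : bid_profile R A T -> matching A T) (a : A)
    (ca ba : cost_vector R T) (bma : bid_profile R (others a) T) :
  payoff cbar f y ca ba bma =
  objective cbar (join_bids ca bma) (y (join_bids ba bma))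
  - best_value_without cbar f bma.
Proof.
rewrite /payoff /reward (objective_split _ _ _ _ a) join_bids_self.
rewrite (others_value_join_bids _ _ _ _ _ ba ca).
under [in RHS]eq_bigr => rs _ do rewrite mulrBl.
rewrite sumrB; ring.
Qed.

Theorem proposition2 (R : realType) (A T : finType)
    (cbar : cost_vector R T) (c : bid_profile R A T) (f : T -> nat)
    (hf : (\sum_(rs : T) f rs = #|A|)%N)
    (y : bid_profile R A T -> matching A T) (hy : matching_rule cbar f y) :
  (forall (a : A) (ba : cost_vector R T) (bma : bid_profile R (others a) T),
      payoff cbar f y (c a) (c a) bma >= payoff cbar f y (c a) ba bma)
  /\ optimal_matching cbar f c (y c).
Proof.
split=> [a ba bma|]; last exact: hy.
rewrite !payoff_objective lerD2r.
have [_ truthful_max] := hy (join_bids (c a) bma).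
have [feasible_ba _] := hy (join_bids ba bma).
exact: truthful_max.
Qed.
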